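(* Let $c\ge1$ and let $\mathfrak q$ be a Leibniz algebra. Then $\mathsf{Z}^{\ast}(\mathfrak q)=0$ if and only if $\mathfrak q$ is $c$-$\mathsf{Lie}$-capable.
   Context: $\mathbb K$ is a field with $\frac12\in\mathbb K$. A Leibniz algebra is a $\mathbb K$-vector space with a bilinear bracket satisfying $[x,[y,z]]=[[x,y],z]-[[x,z],y]$. The upper $\mathsf{Lie}$-central series of a Leibniz algebra $\mathfrak h$ is $\mathcal Z_0^{\mathsf{Lie}}(\mathfrak h)=0$, $\mathcal Z_i^{\mathsf{Lie}}(\mathfrak h)=\{x\in\mathfrak h: [x,h]+[h,x]\in\mathcal Z_{i-1}^{\mathsf{Lie}}(\mathfrak h)\ \forall h\in\mathfrak h\}$, $i\ge1$; these are two-sided ideals. $\mathfrak q$ is $c$-$\mathsf{Lie}$-capable if $\mathfrak q\cong\mathfrak h/\mathcal Z_c^{\mathsf{Lie}}(\mathfrak h)$ for some Leibniz algebra $\mathfrak h$. The $c$-$\mathsf{Lie}$-characteristic ideal $\mathsf{Z}^{\ast}(\mathfrak q)$ is the smallest two-sided ideal $\mathfrak s$ of $\mathfrak q$ such that $\mathfrak q/\mathfrak s$ is $c$-$\mathsf{Lie}$-capable. *)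

(* Defs.v *)
From HB Require Import structures.
From mathcomp Require Import all_boot all_order all_algebra ring_quotient.
From mathcomp Require Import boolp classical_sets.

Set Implicit Arguments.
Unset Strict Implicit.
Unset Printing Implicit Defensive.
Import GRing.Theory.
Import Quotient.
Local Open Scope ring_scope.
Local Open Scope quotient_scope.

HB.mixin Record isLeibniz (K : fieldType) L of GRing.Lmodule K L := {
  bracket : L -> L -> L;
  bracket_linearl : forall y : L, linear (bracket^~ y);
  bracket_linearr : forall x : L, linear (bracket x);
  bracketA : forall x y z : L,
    bracket x (bracket y z) = bracket (bracket x y) z - bracket (bracket x z) y
}.

#[short(type="leibnizAlgType")]
HB.structure Definition Leibniz (K : fieldType) :=
  {L of GRing.Lmodule K L & isLeibniz K L}.

Notation "\[ x , y ]" := (bracket x y)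
  (at level 0, x, y at level 99, format "\[ x ,  y ]") : ring_scope.

Section BracketTheory.
Context (K : fieldType) (L : leibnizAlgType K).
Implicit Types x y z : L.

Lemma bracketDl x y z : \[x + y, z] = \[x, z] + \[y, z].
Proof. by have := bracket_linearl z 1 x y; rewrite !scale1r. Qed.
Lemma bracketDr x y z : \[z, x + y] = \[z, x] + \[z, y].
Proof. by have := bracket_linearr z 1 x y; rewrite !scale1r. Qed.
Lemma bracket0l x : \[0, x] = 0.
Proof. by apply: (addIr \[0, x]); rewrite -bracketDl !add0r. Qed.
Lemma bracket0r x : \[x, 0] = 0.
Proof. by apply: (addIr \[x, 0]); rewrite -bracketDr !add0r. Qed.
Lemma bracketZl (a : K) x z : \[a *: x, z] = a *: \[x, z].
Proof. by have := bracket_linearl z a x 0; rewrite bracket0l !addr0. Qed.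
Lemma bracketZr (a : K) x z : \[z, a *: x] = a *: \[z, x].
Proof. by have := bracket_linearr z a x 0; rewrite bracket0r !addr0. Qed.
Lemma bracketBl x y z : \[x - y, z] = \[x, z] - \[y, z].
Proof. by rewrite -scaleN1r bracketDl bracketZl scaleN1r. Qed.
Lemma bracketBr x y z : \[z, x - y] = \[z, x] - \[z, y].
Proof. by rewrite -scaleN1r bracketDr bracketZr scaleN1r. Qed.

End BracketTheory.

Record leibnizIdeal (K : fieldType) (L : leibnizAlgType K) := LeibnizIdeal {
  ideal_mem :> {pred L};
  ideal_submod : submod_closed ideal_mem;
  ideal_bracketl : forall x y, x \in ideal_mem -> \[x, y] \in ideal_mem;
  ideal_bracketr : forall x y, x \in ideal_mem -> \[y, x] \in ideal_mem
}.

HB.instance Definition _ (K : fieldType) (L : leibnizAlgType K)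
    (I : leibnizIdeal L) :=
  GRing.isSubmodClosed.Build K L (ideal_mem I) (ideal_submod I).

Definition leibniz_quot (K : fieldType) (L : leibnizAlgType K)
    (I : leibnizIdeal L) : Type := {quot (ideal_mem I)}.

Section Quotient.
Context (K : fieldType) (L : leibnizAlgType K) (I : leibnizIdeal L).
Local Notation Q := (leibniz_quot I).

HB.instance Definition _ := GRing.Zmodule.on Q.
HB.instance Definition _ := ZmodQuotient.on Q.

Lemma eq_pi_quot (x y : L) : (\pi_Q x == \pi_Q y) = (x - y \in I).
Proof. by rewrite idealrBE. Qed.

Definition quot_scale (a : K) (u : Q) : Q := \pi_Q (a *: repr u).
Definition quot_bracket (u v : Q) : Q := \pi_Q \[repr u, repr v].

Lemma sub_repr_pi (x : L) : repr (\pi_Q x) - x \in I.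
Proof. by rewrite -eq_pi_quot reprK. Qed.

Lemma pi_scale a x : quot_scale a (\pi_Q x) = \pi_Q (a *: x).
Proof. by apply/eqP; rewrite eq_pi_quot -scalerBr rpredZ ?sub_repr_pi. Qed.

Lemma pi_bracket x y : quot_bracket (\pi_Q x) (\pi_Q y) = \pi_Q \[x, y].
Proof.
apply/eqP; rewrite eq_pi_quot.
set x' := repr _; set y' := repr _.
have -> : \[x', y'] - \[x, y] = \[x' - x, y'] + \[x, y' - y].
  by rewrite bracketBl bracketBr addrA addrNK.
apply: rpredD; first exact/ideal_bracketl/sub_repr_pi.
exact/ideal_bracketr/sub_repr_pi.
Qed.

Lemma piD (x y : L) : \pi_Q (x + y) = \pi_Q x + \pi_Q y.
Proof. exact: raddfD. Qed.
Lemma piB (x y : L) : \pi_Q (x - y) = \pi_Q x - \pi_Q y.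
Proof. exact: raddfB. Qed.

Lemma pi0 : \pi_Q (0 : L) = 0.
Proof. exact: raddf0. Qed.
Lemma pi_eq0 x : (\pi_Q x == 0) = (x \in I).
Proof. by rewrite -pi0 eq_pi_quot subr0. Qed.

Lemma quot_scaleA a b u : quot_scale a (quot_scale b u) = quot_scale (a * b) u.
Proof.
by elim/quotW: u => x; rewrite (pi_scale b) (pi_scale a) (pi_scale (a * b)) scalerA.
Qed.
Lemma quot_scale1 : left_id 1 quot_scale.
Proof. by elim/quotW=> x; rewrite pi_scale scale1r. Qed.
Lemma quot_scaleDr : right_distributive quot_scale +%R.
Proof.
move=> a; elim/quotW=> x; elim/quotW=> y.
by rewrite -piD !pi_scale scalerDr piD.
Qed.
Lemma quot_scaleDl u : {morph quot_scale^~ u : a b / a + b}.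
Proof. by elim/quotW: u => x a b; rewrite !pi_scale scalerDl piD. Qed.

HB.instance Definition _ := GRing.Zmodule_isLmodule.Build K Q
  quot_scaleA quot_scale1 quot_scaleDr quot_scaleDl.

Lemma piZ a x : \pi_Q (a *: x) = a *: \pi_Q x.
Proof. by rewrite -pi_scale. Qed.

Lemma quot_bracket_linearl v : linear (quot_bracket^~ v).
Proof.
elim/quotW: v => z a; elim/quotW=> x; elim/quotW=> y.
rewrite -piZ -piD !pi_bracket.
by rewrite bracketDl bracketZl piD piZ.
Qed.
Lemma quot_bracket_linearr u : linear (quot_bracket u).
Proof.
elim/quotW: u => z a; elim/quotW=> x; elim/quotW=> y.
rewrite -piZ -piD !pi_bracket.
by rewrite bracketDr bracketZr piD piZ.
Qed.
Lemma quot_bracketA u v w : quot_bracket u (quot_bracket v w) =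
  quot_bracket (quot_bracket u v) w - quot_bracket (quot_bracket u w) v.
Proof.
elim/quotW: u => x; elim/quotW: v => y; elim/quotW: w => z.
rewrite (pi_bracket y z) (pi_bracket x y) (pi_bracket x z) !pi_bracket.
by rewrite bracketA piB.
Qed.

HB.instance Definition _ := isLeibniz.Build K Q
  quot_bracket_linearl quot_bracket_linearr quot_bracketA.

Lemma pi_br x y : \pi_Q \[x, y] = \[\pi_Q x, \pi_Q y].
Proof. by rewrite -pi_bracket. Qed.

End Quotient.

Definition leibniz_isog (K : fieldType) (L M : leibnizAlgType K) : Prop :=
  exists f : {linear L -> M}, bijective f /\ {morph f : x y / \[x, y]}.

Section LieCenter.
Context (K : fieldType) (L : leibnizAlgType K).

Fixpoint Lie_ucn_mem (i : nat) : {pred L} :=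
  if i is j.+1 then [pred x | `[< forall h, \[x, h] + \[h, x] \in Lie_ucn_mem j >]]
  else pred1 0.

Lemma Lie_ucnSP i x :
  reflect (forall h, \[x, h] + \[h, x] \in Lie_ucn_mem i) (x \in Lie_ucn_mem i.+1).
Proof. exact: asboolP. Qed.

Lemma Lie_ucn_submod i : submod_closed (Lie_ucn_mem i).
Proof.
elim: i => [|i [Z0 ZD]]; split.
- by rewrite inE.
- by move=> a x y; rewrite !inE => /eqP-> /eqP->; rewrite scaler0 addr0.
- by apply/Lie_ucnSP=> h; rewrite bracket0l bracket0r addr0.
- move=> a x y /Lie_ucnSP Zx /Lie_ucnSP Zy; apply/Lie_ucnSP=> h.
  rewrite bracketDl bracketDr bracketZl bracketZr addrACA -scalerDr.
  exact: ZD.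
Qed.

HB.instance Definition _ i :=
  GRing.isSubmodClosed.Build K L (Lie_ucn_mem i) (Lie_ucn_submod i).

Lemma bracket_sym0 (x y z : L) : \[x, \[y, z] + \[z, y]] = 0.
Proof. by rewrite bracketDr !bracketA addrC addrA addrNK subrr. Qed.

Lemma Lie_ucn_bracket i : (forall x y, x \in Lie_ucn_mem i -> \[x, y] \in Lie_ucn_mem i)
  /\ (forall x y, x \in Lie_ucn_mem i -> \[y, x] \in Lie_ucn_mem i).
Proof.
elim: i => [|i [ZMl ZMr]].
  by split=> x y; rewrite !inE => /eqP->; rewrite (bracket0l, bracket0r).
have ZMl' x y : x \in Lie_ucn_mem i.+1 -> \[x, y] \in Lie_ucn_mem i.+1.
  move=> /Lie_ucnSP Zx; apply/Lie_ucnSP=> h.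
  have E1 : \[\[x, y], h] = \[x, \[y, h]] + \[\[x, h], y].
    by rewrite bracketA addrNK.
  have E2 : \[x, \[y, h]] = - \[x, \[h, y]].
    by apply/eqP; rewrite -addr_eq0 -bracketDr bracket_sym0.
  have -> : \[\[x, y], h] + \[h, \[x, y]] =
      \[\[x, h] + \[h, x], y] - (\[x, \[h, y]] + \[\[h, y], x]).
    by rewrite E1 E2 (bracketA h) bracketDl opprD [- _ + \[_, y]]addrC addrACA.
  by apply: rpredB; [apply: ZMl; apply: Zx | apply: Zx].
split=> // x y Zx.
have -> : \[y, x] = \[x, y] + \[y, x] - \[x, y] by rewrite addrC addKr.
apply: rpredB; last exact: ZMl'.
move/Lie_ucnSP: Zx => Zx; apply/Lie_ucnSP=> h.
by apply: rpredD; [apply: ZMl | apply: ZMr]; rewrite Zx.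
Qed.

Definition Lie_ucn i : leibnizIdeal L := LeibnizIdeal (Lie_ucn_submod i)
  (proj1 (Lie_ucn_bracket i)) (proj2 (Lie_ucn_bracket i)).

End LieCenter.
Arguments Lie_ucn {K} L i.

Lemma Lie_ucn_image (K : fieldType) (L M : leibnizAlgType K) (f : {linear L -> M})
    (i : nat) (x : L) :
  {morph f : x y / \[x, y]} -> (forall y, exists x, f x = y) ->
  x \in Lie_ucn L i -> f x \in Lie_ucn M i.
Proof.
move=> fB fsurj; elim: i x => [|i IH] x.
  by rewrite !inE => /eqP->; rewrite raddf0.
move/Lie_ucnSP=> Zx; apply/Lie_ucnSP=> y; have [z <-] := fsurj y.
by rewrite -!fB -raddfD; apply: IH.
Qed.

Definition Lie_capable (c : nat) (K : fieldType) (q : leibnizAlgType K) : Prop :=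
  exists h : leibnizAlgType K, leibniz_isog q (leibniz_quot (Lie_ucn h c)).

Definition dprod (I : Type) (h : I -> Type) : Type := forall i, h i.
HB.instance Definition _ (I : Type) (h : I -> Type) := gen_eqMixin (dprod h).
HB.instance Definition _ (I : Type) (h : I -> Type) := gen_choiceMixin (dprod h).

Section DirectProduct.
Context (K : fieldType) (I : Type) (h : I -> leibnizAlgType K).
Local Notation H := (dprod h).
Implicit Types f g : H.

Let dadd f g : H := fun i => f i + g i.
Let dopp f : H := fun i => - f i.
Let dscale (a : K) f : H := fun i => a *: f i.
Let dbracket f g : H := fun i => \[f i, g i].

Let daddA : associative dadd.
Proof. by move=> f g k; apply: functional_extensionality_dep => i; apply: addrA. Qed.
Let daddC : commutative dadd.
Proof. by move=> f g; apply: functional_extensionality_dep => i; apply: addrC. Qed.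
Let dadd0 : left_id (fun i => 0) dadd.
Proof. by move=> f; apply: functional_extensionality_dep => i; apply: add0r. Qed.
Let daddN : left_inverse (fun i => 0) dopp dadd.
Proof. by move=> f; apply: functional_extensionality_dep => i; apply: addNr. Qed.
HB.instance Definition _ := GRing.isZmodule.Build H daddA daddC dadd0 daddN.

Let dscaleA a b f : dscale a (dscale b f) = dscale (a * b) f.
Proof. by apply: functional_extensionality_dep => i; apply: scalerA. Qed.
Let dscale1 : left_id 1 dscale.
Proof. by move=> f; apply: functional_extensionality_dep => i; apply: scale1r. Qed.
Let dscaleDr : right_distributive dscale +%R.
Proof. by move=> a f g; apply: functional_extensionality_dep => i; apply: scalerDr. Qed.
Let dscaleDl f : {morph dscale^~ f : a b / a + b}.
Proof. by move=> a b; apply: functional_extensionality_dep => i; apply: scalerDl. Qed.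
HB.instance Definition _ := GRing.Zmodule_isLmodule.Build K H
  dscaleA dscale1 dscaleDr dscaleDl.

Let dbracket_linearl g : linear (dbracket^~ g).
Proof.
by move=> a f k; apply: functional_extensionality_dep => i; apply: bracket_linearl.
Qed.
Let dbracket_linearr f : linear (dbracket f).
Proof.
by move=> a g k; apply: functional_extensionality_dep => i; apply: bracket_linearr.
Qed.
Let dbracketA f g k :
  dbracket f (dbracket g k) = dbracket (dbracket f g) k - dbracket (dbracket f k) g.
Proof. by apply: functional_extensionality_dep => i; apply: bracketA. Qed.
HB.instance Definition _ := isLeibniz.Build K H
  dbracket_linearl dbracket_linearr dbracketA.

Lemma dprodP f g : (forall i, f i = g i) -> f = g.
Proof. exact: functional_extensionality_dep. Qed.

End DirectProduct.

(* Given relations R i between q and h i that are linear, multiplicative, total,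
   surjective and satisfy R i 0 y <-> y in Z_c(h i), the subalgebra
   {g | exists x, forall i, R i x (g i)} of the product of the h i has its Z_c
   computed componentwise. Hence q / t is capable for the ideal
   t = {x | forall i, R i x 0}. *)
Section Pullback.
Context (K : fieldType) (q : leibnizAlgType K) (I : Type).
Context (h : I -> leibnizAlgType K) (R : forall i, q -> h i -> Prop) (c : nat).
Hypothesis R_linear : forall i (a : K) x x' y y',
  @R i x y -> @R i x' y' -> @R i (a *: x + x') (a *: y + y').
Hypothesis R_bracket : forall i x x' y y',
  @R i x y -> @R i x' y' -> @R i \[x, x'] \[y, y'].
Hypothesis R_total : forall i x, exists y, @R i x y.
Hypothesis R_surj : forall i y, exists x, @R i x y.
Hypothesis R_ucn : forall i y, @R i 0 y <-> y \in Lie_ucn (h i) c.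

Definition pullback_mem : {pred dprod h} :=
  [pred g | `[< exists x, forall i, R x (g i) >]].

Lemma pullback_submod : submod_closed pullback_mem.
Proof.
split.
  by apply/asboolP; exists 0 => i; apply/R_ucn; apply: rpred0.
move=> a f g /asboolP[x xf] /asboolP[y yg]; apply/asboolP.
by exists (a *: x + y) => i; apply: R_linear.
Qed.
HB.instance Definition _ :=
  GRing.isSubmodClosed.Build K (dprod h) pullback_mem pullback_submod.

Record pullback := Pullback { pullback_val :> dprod h; _ : pullback_val \in pullback_mem }.
HB.instance Definition _ := [isSub for pullback_val].
HB.instance Definition _ := [Choice of pullback by <:].
HB.instance Definition _ := [SubChoice_isSubLmodule of pullback by <:].

Lemma pullbackP (g : pullback) : exists x, forall i, R x (pullback_val g i).
Proof. by case: g => g gP; exact/asboolP. Qed.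

Lemma pullback_bracket_subproof (f g : pullback) :
  \[pullback_val f, pullback_val g] \in pullback_mem.
Proof.
have [x xf] := pullbackP f; have [y yg] := pullbackP g.
by apply/asboolP; exists \[x, y] => i; apply: R_bracket.
Qed.
Definition pullback_bracket f g := Pullback (pullback_bracket_subproof f g).

Lemma pullback_bracket_linearl g : linear (pullback_bracket^~ g).
Proof. by move=> a f k; apply: val_inj; apply: bracket_linearl. Qed.
Lemma pullback_bracket_linearr f : linear (pullback_bracket f).
Proof. by move=> a g k; apply: val_inj; apply: bracket_linearr. Qed.
Lemma pullback_bracketA f g k :
  pullback_bracket f (pullback_bracket g k) =
  pullback_bracket (pullback_bracket f g) k - pullback_bracket (pullback_bracket f k) g.
Proof. by apply: val_inj; apply: bracketA. Qed.
HB.instance Definition _ := isLeibniz.Build K pullback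
  pullback_bracket_linearl pullback_bracket_linearr pullback_bracketA.

Definition pullback_proj i (g : pullback) : h i := pullback_val g i.
Lemma pullback_proj_linear i : linear (@pullback_proj i).
Proof. by []. Qed.
HB.instance Definition _ i :=
  GRing.isLinear.Build K pullback (h i) *:%R (@pullback_proj i) (@pullback_proj_linear i).

Lemma pullback_lift x : exists g : pullback, forall i, R x (pullback_proj i g).
Proof.
pose g : dprod h := fun i => sval (cid (R_total i x)).
have xg i : R x (g i) by rewrite /g; case: cid.
have gP : g \in pullback_mem by apply/asboolP; exists x.
by exists (Pullback gP).
Qed.

Lemma pullback_proj_surj i (y : h i) : exists g, pullback_proj i g = y.
Proof.
have [x xy] := R_surj y.
have gex j : exists z : h j, R x z /\ forall e : i = j, z = eq_rect i h y j e.
  have [ij|nij] := pselect (i = j); last by have [z xz] := R_total j x; exists z.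
  by subst j; exists y; split=> // e; rewrite (Prop_irrelevance e erefl).
pose g : dprod h := fun j => sval (cid (gex j)).
have gP : g \in pullback_mem.
  by apply/asboolP; exists x => j; rewrite /g; case: cid => z [].
exists (Pullback gP); rewrite /pullback_proj /= /g.
by case: cid => z /= [_ /(_ erefl)].
Qed.

Lemma pullback_ucn n (g : pullback) :
  g \in Lie_ucn pullback n <-> forall i, pullback_proj i g \in Lie_ucn (h i) n.
Proof.
split=> [gZ i|].
  apply: Lie_ucn_image gZ => //; exact: pullback_proj_surj.
elim: n g => [|n IH] g gZ.
  suff -> : g = 0 by apply: (rpred0 (Lie_ucn pullback 0)).
  apply: val_inj; apply: dprodP => i.
  by have := gZ i; rewrite inE => /eqP.
apply/Lie_ucnSP=> k; apply: IH => i.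
by move: (gZ i) => /Lie_ucnSP/(_ (pullback_proj i k)).
Qed.

Lemma pullback_R0 (g : pullback) :
  (forall i, R 0 (pullback_proj i g)) <-> g \in Lie_ucn pullback c.
Proof.
split=> [g0|/pullback_ucn gZ i]; last exact/R_ucn.
by apply/pullback_ucn => i; apply/R_ucn.
Qed.

Lemma R_sub i x x' y y' : @R i x y -> @R i x' y' -> R (x - x') (y - y').
Proof.
move=> xy xy'; rewrite [x - x']addrC [y - y']addrC -!scaleN1r.
exact: R_linear.
Qed.

Lemma pullback_capable (t : leibnizIdeal q) :
  (forall x, x \in t <-> forall i, @R i x 0) -> Lie_capable c (leibniz_quot t).
Proof.
move=> tP; exists pullback.
pose Z := Lie_ucn pullback c.
pose lift x := sval (cid (pullback_lift x)).
pose F (u : leibniz_quot t) : leibniz_quot Z :=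
  \pi_(leibniz_quot Z) (lift (repr u)).
have FE x (g : pullback) : (forall i, R x (pullback_proj i g)) ->
    F (\pi_(leibniz_quot t) x) = \pi_(leibniz_quot Z) g.
  move=> xg; apply/eqP; rewrite eq_pi_quot; apply/pullback_R0 => i.
  have : repr (\pi_(leibniz_quot t) x) - x \in t by apply: sub_repr_pi.
  rewrite /lift; case: cid => g' /= xg' /tP/(_ i) r0.
  have := R_sub (R_sub (xg' i) (xg i)) r0.
  by rewrite subrr subr0.
have Flin : linear F.
  move=> a; elim/quotW=> x; elim/quotW=> y.
  have [g xg] := pullback_lift x; have [k yk] := pullback_lift y.
  rewrite -piZ -piD (FE _ _ xg) (FE _ _ yk) -piZ -piD.
  by apply: FE => i; apply: R_linear; [apply: xg | apply: yk].
have FB : {morph F : u v / \[u, v]}.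
  elim/quotW=> x; elim/quotW=> y.
  have [g xg] := pullback_lift x; have [k yk] := pullback_lift y.
  rewrite -pi_br (FE _ _ xg) (FE _ _ yk) -pi_br.
  by apply: FE => i; apply: R_bracket; [apply: xg | apply: yk].
have Finj : injective F.
  elim/quotW=> x; elim/quotW=> y.
  have [g xg] := pullback_lift x; have [k yk] := pullback_lift y.
  rewrite (FE _ _ xg) (FE _ _ yk) => /eqP.
  rewrite eq_pi_quot => /pullback_R0 gk0.
  apply/eqP; rewrite eq_pi_quot; apply/tP => i.
  have := R_sub (R_sub (xg i) (yk i)) (gk0 i).
  by rewrite subrr subr0.
have Fsurj v : exists u, F u = v.
  elim/quotW: v => g; have [x xg] := pullbackP g.
  by exists (\pi_(leibniz_quot t) x); apply: FE.
pose F' v := sval (cid (Fsurj v)).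
have FF' : cancel F' F by move=> v; rewrite /F'; case: cid.
pose Fl := GRing.isLinear.Build K _ _ *:%R F Flin.
pose FL : {linear leibniz_quot t -> leibniz_quot Z} := HB.pack F Fl.
exists FL; split; last exact: FB.
by exists F' => // u; apply: Finj; rewrite FF'.
Qed.

End Pullback.

(* s is the smallest two-sided ideal with a c-Lie-capable quotient. *)
Definition is_Lie_char_ideal (c : nat) (K : fieldType) (q : leibnizAlgType K)
    (s : leibnizIdeal q) : Prop :=
  Lie_capable c (leibniz_quot s) /\
  forall t : leibnizIdeal q, Lie_capable c (leibniz_quot t) -> {subset s <= t}.

Section LieCharIdeal.
Context (c : nat) (K : fieldType) (q : leibnizAlgType K).

(* The smallest ideal exists for every q: ideals with a capable quotient are
   stable under arbitrary intersections. *)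
Definition capable_meet : {pred q} := [pred x | `[< forall s : leibnizIdeal q,
  Lie_capable c (leibniz_quot s) -> x \in s >]].

Lemma capable_meetP x : reflect (forall s : leibnizIdeal q,
  Lie_capable c (leibniz_quot s) -> x \in s) (x \in capable_meet).
Proof. exact: asboolP. Qed.

Lemma capable_meet_submod : submod_closed capable_meet.
Proof.
split=> [|a x y /capable_meetP xs /capable_meetP ys]; apply/capable_meetP => s sC.
  exact: rpred0.
by apply: rpredD; [apply: rpredZ; apply: xs | apply: ys].
Qed.
Lemma capable_meet_bracketl x y : x \in capable_meet -> \[x, y] \in capable_meet.
Proof.
by move=> /capable_meetP xs; apply/capable_meetP => s /xs; apply: ideal_bracketl.
Qed.
Lemma capable_meet_bracketr x y : x \in capable_meet -> \[y, x] \in capable_meet.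
Proof.
by move=> /capable_meetP xs; apply/capable_meetP => s /xs; apply: ideal_bracketr.
Qed.
Definition capable_meet_ideal : leibnizIdeal q := LeibnizIdeal capable_meet_submod
  capable_meet_bracketl capable_meet_bracketr.

Lemma Lie_char_ideal_exists : exists s : leibnizIdeal q, is_Lie_char_ideal c s.
Proof.
exists capable_meet_ideal; split; last by move=> t tC x /capable_meetP; apply.
pose I := {s : leibnizIdeal q | Lie_capable c (leibniz_quot s)}.
pose h (i : I) := sval (cid (svalP i)).
have fex i : exists f : {linear leibniz_quot (sval i) ->
    leibniz_quot (Lie_ucn (h i) c)}, bijective f /\ {morph f : x y / \[x, y]}.
  by rewrite /h; case: cid.
pose f i := sval (cid (fex i)).
have fbij i : bijective (f i) by rewrite /f; case: cid => ? [].
have fB i : {morph (f i) : x y / \[x, y]} by rewrite /f; case: cid => ? [].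
pose R i (x : q) (y : h i) := f i (\pi_(leibniz_quot (sval i)) x) =
  \pi_(leibniz_quot (Lie_ucn (h i) c)) y.
apply: (@pullback_capable _ _ I h R); rewrite /R.
- move=> i a x x' y y' xy xy'.
  by rewrite piD piZ linearP [LHS]/= xy xy' -piZ -piD.
- by move=> i x x' y y' xy xy'; rewrite pi_br fB xy xy' -pi_br.
- move=> i x; exists (repr (f i (\pi_(leibniz_quot (sval i)) x))).
  by rewrite reprK.
- move=> i y; have [g _ fK] := fbij i.
  exists (repr (g (\pi_(leibniz_quot (Lie_ucn (h i) c)) y))).
  by rewrite reprK fK.
- move=> i y; rewrite pi0 linear0 -pi_eq0; split=> [<- //|/eqP->//].
move=> x; split=> [/capable_meetP xs i|xR].
  have := xs _ (proj2_sig i).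
  by rewrite -pi_eq0 => /eqP->; rewrite linear0 pi0.
apply/capable_meetP => s sC; pose i : I := exist _ s sC.
have [g fK _] := fbij i.
suff /eqP : \pi_(leibniz_quot (sval i)) x = 0 by rewrite pi_eq0.
apply: (can_inj fK).
by rewrite linear0; have := xR i; rewrite pi0.
Qed.

Definition Lie_char_ideal : leibnizIdeal q := sval (cid Lie_char_ideal_exists).

Lemma Lie_char_idealP : is_Lie_char_ideal c Lie_char_ideal.
Proof. by rewrite /Lie_char_ideal; case: cid. Qed.

End LieCharIdeal.

(* Main.v *)
From HB Require Import structures.
Require Import Defs.
From mathcomp Require Import all_boot all_order all_algebra.

Set Implicit Arguments.
Unset Strict Implicit.
Unset Printing Implicit Defensive.
Import GRing.Theory.
Local Open Scope ring_scope.
Local Open Scope quotient_scope.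

(** Capability is invariant under isomorphism ([Lie_capable_isog]), and an algebra is isomorphic to
    its quotient by a zero ideal ([leibniz_quot0_isog]). By [Lie_char_idealP], the quotient by the
    characteristic ideal is itself capable; if that ideal is zero, this quotient is a copy of [q].
    Conversely, if [q] is capable, so is its quotient by zero, and minimality forces the
    characteristic ideal into zero. *)

Lemma leibniz_isog_sym (K : fieldType) (L M : leibnizAlgType K) :
  leibniz_isog L M -> leibniz_isog M L.
Proof.
move=> [f [[g fK gK] fB]].
have glin : linear g by move=> a u v; apply: (can_inj fK); rewrite linearP !gK.
pose gl : {linear M -> L} := HB.pack g (GRing.isLinear.Build K _ _ *:%R g glin).
exists gl; split; first by exists f.
by move=> u v; apply: (can_inj fK); rewrite fB !gK.
Qed.

Lemma leibniz_isog_trans (K : fieldType) (L M N : leibnizAlgType K) :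
  leibniz_isog L M -> leibniz_isog M N -> leibniz_isog L N.
Proof.
move=> [f [f_bij fB]] [g [g_bij gB]].
exists (g \o f : {linear L -> N}); split; first exact: bij_comp.
by move=> x y /=; rewrite fB gB.
Qed.

Lemma Lie_capable_isog (c : nat) (K : fieldType) (L M : leibnizAlgType K) :
  leibniz_isog L M -> Lie_capable c M -> Lie_capable c L.
Proof. by move=> LM [h Mh]; exists h; apply: leibniz_isog_trans Mh. Qed.

(** The projection has kernel [I], so it is bijective with inverse [repr]. Asking only for the
    elements of [I] lets this apply to any ideal record whose sole member is 0. *)
Lemma leibniz_quot0_isog (K : fieldType) (L : leibnizAlgType K)
    (I : leibnizIdeal L) : I =i pred1 0 -> leibniz_isog L (leibniz_quot I).
Proof.
move=> I0; pose Q := leibniz_quot I; pose f (x : L) : Q := \pi_Q x.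
have flin : linear f by move=> a x y; rewrite /f piD piZ.
pose fl : {linear L -> Q} := HB.pack f (GRing.isLinear.Build K _ _ *:%R f flin).
exists fl; split; last by move=> x y; apply: pi_br.
exists (@repr _ Q) => [x|u]; last exact: reprK.
(* The representative of the class of [x] differs from [x] by an element of [I], that is, by 0. *)
by apply/eqP; rewrite -subr_eq0; have := sub_repr_pi I x; rewrite I0.
Qed.

Theorem corollary6p6 (K : fieldType) (half : 2%:R != 0 :> K) (c : nat)
    (c_ge1 : (1 <= c)%N) (q : leibnizAlgType K) :
  (Lie_char_ideal c q =i pred1 0) <-> Lie_capable c q.
Proof.
have [quot_capable char_min] := Lie_char_idealP c q.
split=> [char0|q_capable x].
  exact: Lie_capable_isog (leibniz_quot0_isog char0) quot_capable.
(* Term 0 of the upper central series serves as the zero ideal of [q]. *)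
have q0_capable : Lie_capable c (leibniz_quot (Lie_ucn q 0)).
  apply: Lie_capable_isog q_capable.
  exact/leibniz_isog_sym/leibniz_quot0_isog.
apply/idP/idP => [/(char_min _ q0_capable) //|].
by rewrite inE => /eqP->; apply: rpred0.
Qed.
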